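(* Let $B\in\mathcal{B}$, let $x^\circ$ be a feasible solution for $\mathcal{G}^B$, and let $\omega\in\mathbb{R}^n_+$. Consider $\mathit{Inv}(\mathcal{G}^B,x^\circ)$ under the $L_1$ norm weighted by $\omega$, i.e. the problem of minimizing $\sum_{i=1}^n\omega_i|d_i-c_i|$ over $d\in\mathit{IFR}(\mathcal{G}^B,x^\circ)$. If $(e^*,f^*,y^* )$ is an optimal solution for the linear program $$\begin{aligned} \min\quad & \omega^\intercal(e+f)\\ \text{s.t.}\quad & y_{\mathbf{0}}=0,\\ & y_{Sb}=(\bar c_N-\bar e_N+\bar f_N)^\intercal x^\circ_N,\\ & y_v-y_u\le(\bar c_N)_j-(\bar e_N)_j+(\bar f_N)_j,\qquad\forall (u,v)\in E_j,\ \forall j\in[n-m],\\ & e,f\in\mathbb{R}^n_+,\ y\in\mathbb{R}^{|V|}, \end{aligned}$$ then $c-e^*+f^*$ is an optimal solution for $\mathit{Inv}(\mathcal{G}^B,x^\circ)$ under the $L_1$ norm weighted by $\omega$.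
   Context: Let $m\le n$, let $A\in\mathbb{Z}^{m\times n}$ have full row rank, and let $b\in\mathbb{Z}^m$, $c\in\mathbb{R}^n$. The integer program $\mathcal{IP}$ is $\min\{c^\intercal x\mid Ax=b,\ x\ge\mathbf{0},\ x\in\mathbb{Z}^n\}$, assumed to have nonempty feasible region; its LP relaxation $\mathcal{LP}$ is $\min\{c^\intercal x\mid Ax=b,\ x\ge\mathbf{0},\ x\in\mathbb{R}^n\}$. Write $[k]=\{1,\dots,k\}$. A basis is a set $B\subseteq[n]$ with $|B|=m$ such that the submatrix $A_B$ of columns indexed by $B$ is nonsingular; $N=[n]\setminus B$, $A_N$ is the submatrix of columns indexed by $N$, and for $v\in\mathbb{R}^n$, $v_B,v_N$ are its subvectors indexed by $B,N$. The basis $B$ is feasible for $\mathcal{LP}$ if $A_B^{-1}b\ge\mathbf{0}$. $\mathcal{B}$ is the finite set of all feasible bases of $\mathcal{LP}$. For any $d\in\mathbb{R}^n$ (in particular $d=c,e,f$), $\bar d_N:=(d_N^\intercal-d_B^\intercal A_B^{-1}A_N)^\intercal\in\mathbb{R}^{n-m}$. The Gomory corner relaxation $\mathcal{G}^B$ is $\min\{c_B^\intercal x_B+c_N^\intercal x_N\mid A_Bx_B+A_Nx_N=b,\ x_N\ge\mathbf{0},\ x\in\mathbb{Z}^n\}$. $\mathcal{G}^{B,d}$ is the same problem with $c$ replaced by $d$, and $\mathit{IFR}(\mathcal{G}^B,x^\circ)$ is the set of all $d\in\mathbb{R}^n$ such that $x^\circ$ is an optimal solution for $\mathcal{G}^{B,d}$.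 Graph. Fix a Smith normal form of $A_B$: unimodular $S,T\in\mathbb{Z}^{m\times m}$ and a positive vector $w\in\mathbb{Z}^m$ with $SA_BT=\mathrm{diag}(w)$. For $u,v\in\mathbb{Z}^m$, $u\equiv v\ (\mathrm{mod}\ w)$ means $u_i-v_i$ is an integer multiple of $w_i$ for every $i\in[m]$. The vertex set is $V=\prod_{i\in[m]}\{0,\dots,w_i-1\}$, whose elements represent the classes of $\mathbb{Z}^m$ modulo $w$; elements of $\mathbb{Z}^m$ (such as $Sb$) are identified with their representative in $V$. For $j\in[n-m]$, $E_j=\{(u,u+(SA_N)_j)\mid u\in V\}$ (addition modulo $w$), where $(SA_N)_j$ is the $j$th column of $SA_N$. The vector $y\in\mathbb{R}^{|V|}$ has one component $y_u$ for each $u\in V$. *)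

(* Defs.v *)
From HB Require Import structures.
From mathcomp Require Import all_boot all_order all_algebra.
From mathcomp Require Import reals.

Set Implicit Arguments.
Unset Strict Implicit.
Unset Printing Implicit Defensive.

Import Order.TTheory GRing.Theory Num.Theory.
Local Open Scope ring_scope.

Definition dotv (K : pzRingType) (k : nat) (u v : 'cV[K]_k) : K :=
  (u^T *m v) 0 0.

Definition nonnegv (K : numDomainType) (k : nat) (v : 'cV[K]_k) : Prop :=
  forall i, 0 <= v i 0.

Notation intmx_to R M := (map_mx (intr : int -> R) M).

Definition optimal (R : realType) (T : Type) (feas : T -> Prop) (obj : T -> R)
    (x : T) : Prop :=
  feas x /\ forall x', feas x' -> obj x <= obj x'.

Definition IP_feasible (m n : nat) (A : 'M[int]_(m, n)) (b : 'cV[int]_m)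
    (x : 'cV[int]_n) : Prop :=
  A *m x = b /\ nonnegv x.

(* The columns (resp. rows) selected by [B] and by its complement [N] are listed
   in increasing order.  [B]-indexed objects use [cardB : #|B| = m] to have size
   [m] on the nose, so that the submatrix on [B] is square; [N]-indexed objects
   have size [#|~: B|], which equals [n - m]. *)
Section Basis.
Variables (m n : nat) (B : {set 'I_n}) (cardB : #|B| = m).

Definition idxB (i : 'I_m) : 'I_n := enum_val (cast_ord (esym cardB) i).
Definition idxN (j : 'I_#|~: B|) : 'I_n := enum_val j.

Definition colsB (K : Type) (A : 'M[K]_(m, n)) : 'M[K]_m := colsub idxB A.
Definition colsN (K : Type) (A : 'M[K]_(m, n)) : 'M[K]_(m, #|~: B|) :=
  colsub idxN A.
Definition vecB (K : Type) (v : 'cV[K]_n) : 'cV[K]_m := rowsub idxB v.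
Definition vecN (K : Type) (v : 'cV[K]_n) : 'cV[K]_#|~: B| := rowsub idxN v.

Definition reduced_cost (R : realType) (A : 'M[int]_(m, n)) (d : 'cV[R]_n) :
    'cV[R]_#|~: B| :=
  ((vecN d)^T
   - (vecB d)^T *m invmx (intmx_to R (colsB A)) *m intmx_to R (colsN A))^T.

(* Nonsingularity and the inverse are taken over [R]: over [int], [unitmx] would
   mean unimodular. *)
Definition feasible_basis (R : realType) (A : 'M[int]_(m, n))
    (b : 'cV[int]_m) : Prop :=
  intmx_to R (colsB A) \in unitmx
  /\ nonnegv (invmx (intmx_to R (colsB A)) *m intmx_to R b).

Definition corner_feasible (A : 'M[int]_(m, n)) (b : 'cV[int]_m)
    (x : 'cV[int]_n) : Prop :=
  colsB A *m vecB x + colsN A *m vecN x = b /\ nonnegv (vecN x).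

Definition corner_obj (R : realType) (d : 'cV[R]_n) (x : 'cV[int]_n) : R :=
  dotv (vecB d) (intmx_to R (vecB x)) + dotv (vecN d) (intmx_to R (vecN x)).

Definition IFR (R : realType) (A : 'M[int]_(m, n)) (b : 'cV[int]_m)
    (x0 : 'cV[int]_n) (d : 'cV[R]_n) : Prop :=
  optimal (corner_feasible A b) (corner_obj d) x0.

End Basis.

Definition weighted_L1 (R : realType) (n : nat) (omega c d : 'cV[R]_n) : R :=
  \sum_(i < n) omega i 0 * `|d i 0 - c i 0|.

Definition Inv_optimal (R : realType) (m n : nat) (B : {set 'I_n})
    (cardB : #|B| = m) (A : 'M[int]_(m, n)) (b : 'cV[int]_m) (c : 'cV[R]_n)
    (x0 : 'cV[int]_n) (omega d : 'cV[R]_n) : Prop :=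
  optimal (IFR cardB A b x0) (weighted_L1 omega c) d.

Section Graph.
Variables (m : nat) (w : 'rV[int]_m) (w_gt0 : forall i, 0 < w 0 i).

Definition vertex : finType := {dffun forall i : 'I_m, 'I_(absz (w 0 i))}.

Lemma residue_subproof (z : 'cV[int]_m) (i : 'I_m) :
  (absz (modz (z i ord0) (w ord0 i)) < absz (w ord0 i))%N.
Proof.
have w0 : w 0 i != 0 by rewrite gt_eqF // w_gt0.
by rewrite -ltz_nat gez0_abs ?modz_ge0 // ltz_mod.
Qed.

Definition vertex_of (z : 'cV[int]_m) : vertex :=
  [ffun i => Ordinal (residue_subproof z i)].

Definition vertex_vec (u : vertex) : 'cV[int]_m := \col_i (u i : nat)%:Z.

(* The arc set E_j is [arcs] at the [j]-th column of [S A_N]. *)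
Definition arcs (a : 'cV[int]_m) : {set vertex * vertex} :=
  [set (u, vertex_of (vertex_vec u + a)) | u : vertex].

End Graph.

(* The divisibility chain on the diagonal is not required. *)
Definition smith_form (m : nat) (M S T : 'M[int]_m) (w : 'rV[int]_m) : Prop :=
  [/\ S \in unitmx, T \in unitmx & S *m M *m T = diag_mx w].

Section InverseLP.
Variables (R : realType) (m n : nat) (B : {set 'I_n}) (cardB : #|B| = m).
Variables (A : 'M[int]_(m, n)) (b : 'cV[int]_m) (c : 'cV[R]_n).
Variables (S : 'M[int]_m) (w : 'rV[int]_m) (w_gt0 : forall i, 0 < w 0 i).
Variables (x0 : 'cV[int]_n) (omega : 'cV[R]_n).

Definition invLP_point : Type :=
  ('cV[R]_n * 'cV[R]_n * {ffun vertex w -> R})%type.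

Definition invLP_feasible (p : invLP_point) : Prop :=
  let: (e, f, y) := p in
  let r := reduced_cost cardB A c - reduced_cost cardB A e
           + reduced_cost cardB A f in
  [/\ y (vertex_of w_gt0 0) = 0,
      y (vertex_of w_gt0 (S *m b)) = dotv r (intmx_to R (vecN B x0)),
      forall (j : 'I_#|~: B|) (u v : vertex w),
        (u, v) \in arcs w_gt0 (col j (S *m colsN B A)) -> y v - y u <= r j 0,
      nonnegv e & nonnegv f].

Definition invLP_obj (p : invLP_point) : R :=
  let: (e, f, _) := p in dotv omega (e + f).

Definition invLP_optimal : invLP_point -> Prop :=
  optimal invLP_feasible invLP_obj.

End InverseLP.

(* Main.v *)
Require Import Defs.
From HB Require Import structures.
From mathcomp Require Import all_boot all_order all_algebra.
From mathcomp Require Import classical_sets reals.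

Set Implicit Arguments.
Unset Strict Implicit.
Unset Printing Implicit Defensive.

Import Order.TTheory GRing.Theory Num.Theory.
Local Open Scope ring_scope.

(** Write [d = c - e + f].  Eliminating the basic variables turns the objective
    of the corner relaxation into a constant plus [r^T x_N], where [r] is the
    reduced cost of [d] ([corner_obj_reduced]), and the Smith form turns its
    constraints into [x_N >= 0] and [S A_N x_N = S b] modulo [w]
    ([corner_feasible_vertex]).  A feasible [x_N] is thus a walk from [0] to
    [S b] in the graph, of cost [r^T x_N], and [x0] is optimal exactly when
    [x0_N] is a cheapest such walk ([IFR_reduced]).

    The constraints of the linear program say that [y] is a potential with
    [y_0 = 0] and [y_(Sb) = r^T x0_N].  If such a [y] exists, summing the arc
    inequalities along a walk to [S b] shows that no walk is cheaper than
    [x0_N], so [d] is feasible for the inverse problem ([invLP_feasible_IFR]).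
    Conversely, if [x0] is optimal for [d], then [r >= 0], because the graph is
    that of a finite group ([IFR_reduced_cost_ge0]).  Hence the distances from
    [0] form a potential.  They are infinite at unreachable vertices, so they
    are capped at [r^T x0_N], which for [r >= 0] preserves the arc inequalities
    and leaves [S b] at [r^T x0_N] by optimality ([IFR_invLP_feasible]).

    It remains to compare objectives.  The weighted distance from [c] to
    [c - e + f] is at most [omega^T (e + f)], and every [d] is [c - e + f] for
    some [e, f >= 0] with equality.  Therefore an optimal [(e, f, y)] gives a
    [d] at least as close to [c] as any other feasible one. *)

(** * Dot products and reduced costs *)

Lemma dotvE (K : pzRingType) (k : nat) (u v : 'cV[K]_k) :
  dotv u v = \sum_i u i 0 * v i 0.
Proof. by rewrite /dotv mxE; apply: eq_bigr => i _; rewrite !mxE. Qed.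

Lemma dotvDr (K : pzRingType) (k : nat) (u v x : 'cV[K]_k) :
  dotv x (u + v) = dotv x u + dotv x v.
Proof. by rewrite /dotv mulmxDr mxE. Qed.

Lemma dotv_delta (K : pzRingType) (k : nat) (u : 'cV[K]_k) (j : 'I_k) :
  dotv u (delta_mx j 0) = u j 0.
Proof. by rewrite /dotv -colE !mxE. Qed.

Lemma dotv_ge0 (R : numDomainType) (k : nat) (u v : 'cV[R]_k) :
  nonnegv u -> nonnegv v -> 0 <= dotv u v.
Proof. by move=> u0 v0; rewrite dotvE sumr_ge0 // => i _; rewrite mulr_ge0. Qed.

Lemma nonnegv_intmx (R : numDomainType) (k : nat) (z : 'cV[int]_k) :
  nonnegv z -> nonnegv (intmx_to R z).
Proof. by move=> z0 i; rewrite mxE ler0z. Qed.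

Lemma reduced_cost_shift (R : realType) (m n : nat) (B : {set 'I_n})
    (cardB : #|B| = m) (A : 'M[int]_(m, n)) (c e f : 'cV[R]_n) :
  reduced_cost cardB A c - reduced_cost cardB A e + reduced_cost cardB A f
  = reduced_cost cardB A (c - e + f).
Proof.
have vBE : vecB cardB (c - e + f) = vecB cardB c - vecB cardB e + vecB cardB f.
  by apply/matrixP=> i j; rewrite !mxE.
have vNE : vecN B (c - e + f) = vecN B c - vecN B e + vecN B f.
  by apply/matrixP=> i j; rewrite !mxE.
rewrite /reduced_cost vBE vNE -linearB -linearD; congr (_^T).
rewrite !linearD !linearN /= !mulmxDl !mulNmx.
rewrite [in RHS]opprD [in RHS]addrACA; congr (_ + _).
by rewrite [in RHS]opprD addrACA.
Qed.

(** Eliminating the basic variables with [A_B x_B = b - A_N x_N] leaves an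
    objective that depends on [x_N] alone, up to a constant. *)
Lemma corner_obj_reduced (R : realType) (m n : nat) (B : {set 'I_n})
    (cardB : #|B| = m) (A : 'M[int]_(m, n)) (b : 'cV[int]_m) (d : 'cV[R]_n)
    (x : 'cV[int]_n) :
  intmx_to R (colsB cardB A) \in unitmx ->
  corner_feasible cardB A b x ->
  corner_obj cardB d x
  = dotv (vecB cardB d) (invmx (intmx_to R (colsB cardB A)) *m intmx_to R b)
    + dotv (reduced_cost cardB A d) (intmx_to R (vecN B x)).
Proof.
move=> AB_unit [Axb _].
rewrite /corner_obj -Axb map_mxD !map_mxM mulmxDr mulKmx // dotvDr -addrA.
congr (_ + _); rewrite /dotv /reduced_cost trmxK mulmxBl !mulmxA.
by rewrite [X in _ = _ + X]mxE [X in _ = _ + (_ + X)]mxE addrC subrK.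
Qed.

Lemma corner_point_exists (m n : nat) (B : {set 'I_n}) (cardB : #|B| = m)
    (K : nmodType) (xB : 'cV[K]_m) (xN : 'cV[K]_#|~: B|) :
  exists x, vecB cardB x = xB /\ vecN B x = xN.
Proof.
have injB : injective (idxB cardB).
  by move=> k l /enum_val_inj /cast_ord_inj.
have disj k (j : 'I_#|~: B|) : (idxB cardB k == idxN j) = false.
  apply/negP=> /eqP kj; have := enum_valP j.
  by rewrite inE -[enum_val j]/(idxN j) -kj (enum_valP (cast_ord _ k)).
(* Each of the two sums has at most one term, and only one is nonempty. *)
exists (\col_i (\sum_(k | idxB cardB k == i) xB k 0
                + \sum_(j | idxN j == i) xN j 0)); split.
  apply/colP=> k; rewrite !mxE [X in _ + X]big1 => [|j].
    by rewrite addr0 (big_pred1 k) // => l; rewrite (inj_eq injB).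
  by rewrite eq_sym disj.
apply/colP=> j; rewrite !mxE [X in X + _]big1 => [|k]; last by rewrite disj.
by rewrite add0r (big_pred1 j) // => l; rewrite (inj_eq enum_val_inj).
Qed.

(** * Residues modulo [w] and corner points *)

Lemma vertex_vec_of (m : nat) (w : 'rV[int]_m) (w_gt0 : forall i, 0 < w 0 i)
    (z : 'cV[int]_m) (i : 'I_m) :
  vertex_vec (vertex_of w_gt0 z) i 0 = modz (z i 0) (w 0 i).
Proof. by rewrite mxE ffunE /= gez0_abs // modz_ge0 // gt_eqF. Qed.

Lemma vertex_vecK (m : nat) (w : 'rV[int]_m) (w_gt0 : forall i, 0 < w 0 i) :
  cancel (@vertex_vec m w) (vertex_of w_gt0).
Proof.
move=> u; apply/ffunP=> i; apply/val_inj; rewrite ffunE /= mxE.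
rewrite modz_small //= -{2}(gtz0_abs (w_gt0 i)).
by rewrite ltz_nat ltn_ord.
Qed.

Lemma eq_vertex_of (m : nat) (w : 'rV[int]_m) (w_gt0 : forall i, 0 < w 0 i)
    (u v : 'cV[int]_m) :
  vertex_of w_gt0 u = vertex_of w_gt0 v
  <-> exists q : 'cV[int]_m, u = v + diag_mx w *m q.
Proof.
split=> [uv | [q ->]].
  exists (\col_i (divz (u i 0) (w 0 i) - divz (v i 0) (w 0 i))).
  apply/colP=> i; rewrite mul_diag_mx !mxE.
  have := congr1 (fun t => vertex_vec t i 0) uv; rewrite !vertex_vec_of => uvi.
  rewrite [LHS](divz_eq _ (w 0 i)) uvi [X in _ = X + _](divz_eq _ (w 0 i)).
  by rewrite [w 0 i * _]mulrC mulrBl [RHS]addrC [RHS]addrA subrK.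
apply/ffunP=> i; apply/val_inj; rewrite !ffunE /= mul_diag_mx !mxE.
by rewrite addrC mulrC modzMDl.
Qed.

Lemma vertex_ofDl (m : nat) (w : 'rV[int]_m) (w_gt0 : forall i, 0 < w 0 i)
    (z a : 'cV[int]_m) :
  vertex_of w_gt0 (vertex_vec (vertex_of w_gt0 z) + a)
  = vertex_of w_gt0 (z + a).
Proof.
have /eq_vertex_of[q E] := vertex_vecK w_gt0 (vertex_of w_gt0 z).
by apply/eq_vertex_of; exists q; rewrite E addrAC.
Qed.

Lemma mem_arcs (m : nat) (w : 'rV[int]_m) (w_gt0 : forall i, 0 < w 0 i)
    (z a : 'cV[int]_m) :
  (vertex_of w_gt0 z, vertex_of w_gt0 (z + a)) \in arcs w_gt0 a.
Proof. by apply/imsetP; exists (vertex_of w_gt0 z); rewrite // vertex_ofDl. Qed.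

(** Projection of the corner relaxation on the nonbasic variables: since
    [S A_B T = diag w], the equation [A_B x_B = b - A_N z] has an integral
    solution exactly when [S A_N z] and [S b] are congruent modulo [w]. *)
Lemma corner_feasible_vertex (m n : nat) (B : {set 'I_n}) (cardB : #|B| = m)
    (A : 'M[int]_(m, n)) (b : 'cV[int]_m) (S T : 'M[int]_m) (w : 'rV[int]_m)
    (w_gt0 : forall i, 0 < w 0 i) (SNF : smith_form (colsB cardB A) S T w)
    (z : 'cV[int]_#|~: B|) :
  (exists2 x, corner_feasible cardB A b x & vecN B x = z)
  <-> nonnegv z /\
      vertex_of w_gt0 (S *m colsN B A *m z) = vertex_of w_gt0 (S *m b).
Proof.
case: SNF => S_unit T_unit SNF; split=> [[x [Axb x_ge0] <-] | [z_ge0]].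
  split=> //; apply/esym/eq_vertex_of; exists (invmx T *m vecB cardB x).
  by rewrite -SNF -Axb mulmxDr !mulmxA mulmxK // addrC.
move/esym/eq_vertex_of=> [q Sb].
have [x [xB xN]] := corner_point_exists cardB (T *m q) z.
exists x => //; split; rewrite xN // xB.
apply: (can_inj (mulKmx S_unit)).
by rewrite Sb mulmxDr !mulmxA SNF addrC.
Qed.

(** * Potentials on the group graph *)

(** Every nonnegative integer combination of the columns of [M] is a walk from
    the zero vertex, so a potential bounds its cost from below. *)
Lemma potential_le_walk (R : realType) (m k : nat) (w : 'rV[int]_m)
    (w_gt0 : forall i, 0 < w 0 i) (M : 'M[int]_(m, k)) (r : 'cV[R]_k)
    (y : vertex w -> R) (y0 : y (vertex_of w_gt0 0) = 0)
    (y_arcs : forall (j : 'I_k) (u v : vertex w),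
        (u, v) \in arcs w_gt0 (col j M) -> y v - y u <= r j 0)
    (z : 'cV[int]_k) (z_ge0 : nonnegv z) :
  y (vertex_of w_gt0 (M *m z)) <= dotv r (intmx_to R z).
Proof.
have [s] := ubnP (\sum_j absz (z j 0%R)); elim: s => // s IHs in z z_ge0 *.
rewrite ltnS => z_le_s.
have [/forallP z0 | /forallPn[j zj_neq0]] := boolP [forall j, z j 0 == 0].
  have -> : z = 0 by apply/colP=> j; rewrite mxE; apply/eqP.
  by rewrite mulmx0 y0 map_mx0 /dotv mulmx0 mxE.
(* Remove the last arc of the walk, taken from column [j]. *)
pose z' : 'cV[int]_k := z - delta_mx j 0.
have zE : z = z' + delta_mx j 0 by rewrite subrK.
have zj_gt0 : 0 < z j 0 by rewrite lt_neqAle eq_sym zj_neq0 z_ge0.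
have z'E i : i != j -> z' i 0 = z i 0.
  by move=> ij; rewrite !mxE (negPf ij) subr0.
have z'j : z' j 0 = z j 0 - 1 by rewrite !mxE !eqxx.
have z'_ge0 : nonnegv z'.
  move=> i; have [->|/z'E ->//] := eqVneq i j.
  by rewrite z'j subr_ge0 -gtz0_ge1.
have {}IHs := IHs _ z'_ge0.
rewrite zE mulmxDr -colE map_mxD map_delta_mx dotvDr dotv_delta.
rewrite -[leLHS](subrK (y (vertex_of w_gt0 (M *m z')))) addrC lerD //.
  apply: IHs => //; apply: leq_trans z_le_s.
  rewrite (bigD1 j) //= [X in (_ < X)%N](bigD1 j) //= -addSn leq_add //.
    rewrite z'j; case: (z j 0) zj_gt0 => // -[|p] // _.
    by rewrite intS addrAC subrr add0r.
  by apply: leq_sum => i /z'E->.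
exact: y_arcs (mem_arcs _ _ _).
Qed.

(** The cost of a shortest walk from the zero vertex to [u], capped at [M0].
    The cap makes the value finite at vertices that no walk reaches, and keeps
    the arc inequalities as long as the costs are nonnegative. *)
Definition capped_distance (R : realType) (m k : nat) (w : 'rV[int]_m)
    (w_gt0 : forall i, 0 < w 0 i) (M : 'M[int]_(m, k)) (r : 'cV[R]_k) (M0 : R)
    (u : vertex w) : R :=
  inf [set t | t = M0 \/ exists z : 'cV[int]_k,
         [/\ nonnegv z, vertex_of w_gt0 (M *m z) = u
           & t = dotv r (intmx_to R z)]]%classic.

Section CappedDistance.
Variables (R : realType) (m k : nat) (w : 'rV[int]_m).
Variables (w_gt0 : forall i, 0 < w 0 i) (M : 'M[int]_(m, k)) (r : 'cV[R]_k).
Variables (M0 : R) (r_ge0 : nonnegv r) (M0_ge0 : 0 <= M0).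

Let dist := capped_distance w_gt0 M r M0.

(** Holds without a sign condition on [r], whereas the upper bounds below need
    the infimum to be over a set bounded from below. *)
Lemma capped_distance_ge (t : R) (u : vertex w) :
  t <= M0 ->
  (forall z, nonnegv z -> vertex_of w_gt0 (M *m z) = u ->
     t <= dotv r (intmx_to R z)) ->
  t <= dist u.
Proof.
move=> tM tz; apply: lb_le_inf; first by exists M0; left.
by move=> _ [-> | [z [z0 zu ->]]] //; apply: tz.
Qed.

Lemma capped_distance_ge0 (u : vertex w) : 0 <= dist u.
Proof.
apply: capped_distance_ge => // z z0 _.
by apply: dotv_ge0 => //; apply: nonnegv_intmx.
Qed.

Lemma capped_distance_le_cap (u : vertex w) : dist u <= M0.
Proof.
apply: ge_inf; last by left.
exists 0 => _ [-> // | [z [z0 _ ->]]].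
by apply: dotv_ge0 => //; apply: nonnegv_intmx.
Qed.

Lemma capped_distance_le_walk (z : 'cV[int]_k) :
  nonnegv z -> dist (vertex_of w_gt0 (M *m z)) <= dotv r (intmx_to R z).
Proof.
move=> z_ge0; apply: ge_inf; last by right; exists z.
exists 0 => _ [-> // | [z' [z0 _ ->]]].
by apply: dotv_ge0 => //; apply: nonnegv_intmx.
Qed.

Lemma capped_distance0 : dist (vertex_of w_gt0 0) = 0.
Proof.
apply/eqP; rewrite eq_le capped_distance_ge0 andbT.
have z0 : nonnegv (0 : 'cV[int]_k) by move=> i; rewrite mxE.
by have := capped_distance_le_walk z0; rewrite mulmx0 map_mx0 /dotv mulmx0 mxE.
Qed.

Lemma capped_distance_arcs (j : 'I_k) (u v : vertex w) :
  (u, v) \in arcs w_gt0 (col j M) -> dist v - dist u <= r j 0.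
Proof.
case/imsetP=> {}u _ [-> ->]; rewrite lerBlDr -lerBlDl.
apply: capped_distance_ge => [|z z_ge0 <-]; rewrite lerBlDl.
  by apply: le_trans (capped_distance_le_cap _) _; rewrite lerDr.
rewrite vertex_ofDl colE -mulmxDr.
apply: le_trans (capped_distance_le_walk _) _.
  by move=> i; rewrite mxE addr_ge0 // mxE; case: (_ && _).
by rewrite map_mxD map_delta_mx dotvDr dotv_delta addrC.
Qed.

End CappedDistance.

(** * Optimality in the corner relaxation *)

Section Corner.
Variables (R : realType) (m n : nat) (B : {set 'I_n}) (cardB : #|B| = m).
Variables (A : 'M[int]_(m, n)) (b : 'cV[int]_m) (S T : 'M[int]_m).
Variables (w : 'rV[int]_m) (w_gt0 : forall i, 0 < w 0 i).
Variables (x0 : 'cV[int]_n).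
Hypothesis AB_unit : intmx_to R (colsB cardB A) \in unitmx.
Hypothesis SNF : smith_form (colsB cardB A) S T w.
Hypothesis x0_feas : corner_feasible cardB A b x0.

(** Optimality of [x0] for the cost [d] is a statement about the reduced costs:
    [x0_N] is a cheapest walk from the zero vertex to the vertex of [S b]. *)
Lemma IFR_reduced (d : 'cV[R]_n) :
  IFR cardB A b x0 d <->
  forall z, nonnegv z ->
    vertex_of w_gt0 (S *m colsN B A *m z) = vertex_of w_gt0 (S *m b) ->
    dotv (reduced_cost cardB A d) (intmx_to R (vecN B x0))
    <= dotv (reduced_cost cardB A d) (intmx_to R z).
Proof.
split=> [[_ x0_opt] z z_ge0 zSb | x0_opt].
  have [x x_feas <-] :=
    (corner_feasible_vertex b w_gt0 SNF z).2 (conj z_ge0 zSb).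
  have := x0_opt x x_feas.
  by rewrite (corner_obj_reduced _ AB_unit x_feas)
             (corner_obj_reduced _ AB_unit x0_feas) lerD2l.
split=> // x x_feas; rewrite (corner_obj_reduced _ AB_unit x_feas).
rewrite (corner_obj_reduced _ AB_unit x0_feas) lerD2l.
have [] := (corner_feasible_vertex b w_gt0 SNF (vecN B x)).1; first by exists x.
exact: x0_opt.
Qed.

Lemma corner_point_vertex :
  vertex_of w_gt0 (S *m colsN B A *m vecN B x0) = vertex_of w_gt0 (S *m b).
Proof.
have [] // := (corner_feasible_vertex b w_gt0 SNF (vecN B x0)).1.
by exists x0.
Qed.

(** Repeating an arc of the [j]-th column [\prod_i w_i] times is a closed walk,
    which may be added to [x0_N]; a negative [j]-th reduced cost would then
    contradict optimality. *)
Lemma IFR_reduced_cost_ge0 (d : 'cV[R]_n) :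
  IFR cardB A b x0 d -> nonnegv (reduced_cost cardB A d).
Proof.
move/IFR_reduced=> x0_opt j.
pose K := \prod_i w 0 i.
have K_gt0 : 0 < K by apply: prodr_gt0.
have z_ge0 : nonnegv (vecN B x0 + K *: delta_mx j 0).
  move=> i; rewrite mxE addr_ge0 //; first by case: x0_feas.
  by rewrite !mxE mulr_ge0 ?(ltW K_gt0) //; case: (_ && _).
have := x0_opt _ z_ge0; rewrite map_mxD dotvDr lerDl => rK.
have: 0 <= dotv (reduced_cost cardB A d) (intmx_to R (K *: delta_mx j 0)).
  apply: rK; rewrite -corner_point_vertex mulmxDr; apply/eq_vertex_of.
  (* [\prod_l w_l] times column [j] is [diag w] times this vector. *)
  exists (\col_i ((\prod_(l | l != i) w 0 l)
                  * (S *m colsN B A) i j)); congr (_ + _).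
  apply/colP=> i; rewrite -scalemxAr -colE mul_diag_mx !mxE mulrA.
  by congr (_ * _); rewrite /K (bigD1 i).
rewrite map_mxZ map_delta_mx /dotv -scalemxAr mxE -[(_ *m _) 0 0]/(dotv _ _).
by rewrite dotv_delta pmulr_rge0 // ltr0z.
Qed.

End Corner.

(** * The inverse linear program *)

Lemma weighted_L1_le (R : realType) (n : nat) (omega c e f : 'cV[R]_n) :
  nonnegv omega -> nonnegv e -> nonnegv f ->
  weighted_L1 omega c (c - e + f) <= dotv omega (e + f).
Proof.
move=> omega_ge0 e_ge0 f_ge0; rewrite dotvE ler_sum // => i _.
have -> : (c - e + f) i 0 - c i 0 = - e i 0 + f i 0.
  by apply/eqP; rewrite subr_eq !mxE -addrA addrC.
rewrite ler_wpM2l // mxE.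
by rewrite (le_trans (ler_normD _ _)) // normrN !ger0_norm.
Qed.

(** The positive and negative parts of [c - d], as [e] and [f], represent [d]
    at no extra cost. *)
Lemma weighted_L1_split (R : realType) (n : nat) (omega c d : 'cV[R]_n) :
  exists e f : 'cV[R]_n,
    [/\ nonnegv e, nonnegv f, c - e + f = d
      & dotv omega (e + f) = weighted_L1 omega c d].
Proof.
exists (\col_i Num.max 0 (c i 0 - d i 0)), (\col_i Num.max 0 (d i 0 - c i 0)).
split.
- by move=> i; rewrite mxE le_max lexx.
- by move=> i; rewrite mxE le_max lexx.
- apply/colP=> i; rewrite !mxE.
  case: (leP (c i 0) (d i 0)) => cd.
    by rewrite max_l ?subr_le0 // max_r ?subr_ge0 // subr0 addrC subrK.
  rewrite max_r ?subr_ge0 ?ltW // max_l ?subr_le0 ?ltW // addr0.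
  by rewrite opprB addrC subrK.
rewrite dotvE; apply: eq_bigr => i _; rewrite !mxE; congr (_ * _).
case: (leP (c i 0) (d i 0)) => cd.
  by rewrite max_l ?subr_le0 // max_r ?subr_ge0 // add0r ger0_norm ?subr_ge0.
rewrite max_r ?subr_ge0 ?ltW // max_l ?subr_le0 ?ltW // addr0.
by rewrite distrC ger0_norm ?subr_ge0 // ltW.
Qed.

Lemma invLP_feasible_IFR (R : realType) (m n : nat) (B : {set 'I_n})
    (cardB : #|B| = m) (A : 'M[int]_(m, n)) (b : 'cV[int]_m) (c : 'cV[R]_n)
    (S T : 'M[int]_m) (w : 'rV[int]_m) (w_gt0 : forall i, 0 < w 0 i)
    (x0 : 'cV[int]_n) (e f : 'cV[R]_n) (y : {ffun vertex w -> R}) :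
  intmx_to R (colsB cardB A) \in unitmx ->
  smith_form (colsB cardB A) S T w ->
  corner_feasible cardB A b x0 ->
  invLP_feasible cardB A b c S w_gt0 x0 (e, f, y) ->
  IFR cardB A b x0 (c - e + f).
Proof.
move=> AB_unit SNF x0_feas [y0 ySb y_arcs _ _].
apply/(IFR_reduced w_gt0 AB_unit SNF x0_feas) => z z_ge0 zSb.
rewrite -reduced_cost_shift -ySb -zSb.
exact: potential_le_walk y0 y_arcs _ z_ge0.
Qed.

(** The potential is the distance from the zero vertex, capped at the cost of
    [x0_N]; by optimality this cap is attained at the vertex of [S b]. *)
Lemma IFR_invLP_feasible (R : realType) (m n : nat) (B : {set 'I_n})
    (cardB : #|B| = m) (A : 'M[int]_(m, n)) (b : 'cV[int]_m) (c : 'cV[R]_n)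
    (S T : 'M[int]_m) (w : 'rV[int]_m) (w_gt0 : forall i, 0 < w 0 i)
    (x0 : 'cV[int]_n) (e f : 'cV[R]_n) :
  intmx_to R (colsB cardB A) \in unitmx ->
  smith_form (colsB cardB A) S T w ->
  corner_feasible cardB A b x0 ->
  nonnegv e -> nonnegv f -> IFR cardB A b x0 (c - e + f) ->
  exists y, invLP_feasible cardB A b c S w_gt0 x0 (e, f, y).
Proof.
move=> AB_unit SNF x0_feas e_ge0 f_ge0 x0_opt.
have r_ge0 := IFR_reduced_cost_ge0 w_gt0 AB_unit SNF x0_feas x0_opt.
move/(IFR_reduced w_gt0 AB_unit SNF x0_feas): x0_opt => x0_opt.
have x0N_ge0 : nonnegv (vecN B x0) by case: x0_feas.
set r := reduced_cost cardB A (c - e + f) in r_ge0 x0_opt.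
pose M0 := dotv r (intmx_to R (vecN B x0)).
have M0_ge0 : 0 <= M0 by apply: dotv_ge0 => //; apply: nonnegv_intmx.
exists [ffun u => capped_distance w_gt0 (S *m colsN B A) r M0 u].
rewrite /invLP_feasible reduced_cost_shift -/r; split=> //.
- by rewrite ffunE capped_distance0.
- rewrite ffunE; apply/eqP; rewrite eq_le capped_distance_le_cap //=.
  by apply: capped_distance_ge => // z; apply: x0_opt.
- by move=> j u v uv; rewrite !ffunE capped_distance_arcs.
Qed.

Theorem proposition3 (R : realType) (m n : nat) (le_mn : (m <= n)%N)
    (A : 'M[int]_(m, n)) (A_full : row_free (intmx_to R A))
    (b : 'cV[int]_m) (c : 'cV[R]_n)
    (IP_nonempty : exists x : 'cV[int]_n, IP_feasible A b x)
    (B : {set 'I_n}) (cardB : #|B| = m) (B_feas : feasible_basis cardB R A b)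
    (S T : 'M[int]_m) (w : 'rV[int]_m) (w_gt0 : forall i : 'I_m, 0 < w 0 i)
    (SNF : smith_form (colsB cardB A) S T w)
    (x0 : 'cV[int]_n) (x0_feas : corner_feasible cardB A b x0)
    (omega : 'cV[R]_n) (omega_ge0 : nonnegv omega)
    (e f : 'cV[R]_n) (y : {ffun vertex w -> R}) :
  invLP_optimal cardB A b c S w_gt0 x0 omega (e, f, y) ->
  Inv_optimal cardB A b c x0 omega (c - e + f).
Proof.
have [AB_unit _] := B_feas.
case=> efy_feas efy_opt; have [_ _ _ e_ge0 f_ge0] := efy_feas.
split; first exact: invLP_feasible_IFR SNF x0_feas efy_feas.
move=> d d_IFR.
have [e' [f' [e'_ge0 f'_ge0 dE <-]]] := weighted_L1_split omega c d.
rewrite -dE in d_IFR.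
have [y' y'_feas] :=
  IFR_invLP_feasible w_gt0 AB_unit SNF x0_feas e'_ge0 f'_ge0 d_IFR.
apply: le_trans (efy_opt _ y'_feas).
exact: weighted_L1_le.
Qed.
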